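(* Let $G$ be a connected $4K_1$-free graph. Then $G$ has a Hamiltonian path if and only if (a) for every articulation point $x$ of $G$, the graph $G-\{x\}$ has exactly 2 connected components, and (b) there are no 3 articulation points of $G$ inducing a triangle in $G$. Moreover, if $G$ does not have a Hamiltonian path, then $G$ has a path cover of size 2 (i.e., its vertex set can be covered by two vertex-disjoint paths).
   Context: Graphs are finite, simple and undirected. A graph is $4K_1$-free if it contains no four pairwise non-adjacent vertices (independence number at most 3). A Hamiltonian path is a path containing all vertices of the graph. An articulation point of $G$ is a vertex $x$ such that $G-\{x\}$ is disconnected. *)

(* Defs.v *)
(* MathComp. A finite simple undirected graph is a symmetric irreflexive
   [e : rel T] on a finite type [T] of vertices; symmetry and irreflexivity are
   hypotheses of the theorem. *)
From mathcomp Require Import all_boot.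

Set Implicit Arguments.
Unset Strict Implicit.
Unset Printing Implicit Defensive.

Section Graphs.

Variables (T : finType) (e : rel T).

(* The subgraph induced by [A], kept on the ambient vertex type: vertices
   outside [A] become isolated, and [num_components] does not count them. *)
Definition induced (A : {set T}) : rel T :=
  [rel u v | [&& u \in A, v \in A & e u v]].

Definition num_components (A : {set T}) : nat := n_comp (induced A) A.

(* In particular a connected graph has at least one vertex. *)
Definition connected_graph : Prop := num_components [set: T] = 1.

Definition stable (A : {set T}) : Prop := {in A &, forall u v, ~~ e u v}.

Definition fourK1_free : Prop := ~ exists2 A : {set T}, #|A| = 4 & stable A.

(* "Disconnected" means having at least two components, so the only vertex of
   a one-vertex graph is not an articulation point. *)
Definition articulation (x : T) : Prop := 1 < num_components [set~ x].

Definition graph_path (p : seq T) : bool :=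
  [&& p != [::], sorted e p & uniq p].

Definition has_hamiltonian_path : Prop :=
  exists2 p : seq T, graph_path p & forall v, v \in p.

Definition has_path_cover (k : nat) : Prop :=
  exists P : seq (seq T),
    [/\ size P = k,
        all graph_path P,
        pairwise (fun p q => [disjoint p & q]) P
      & forall v, has (fun p => v \in p) P].

End Graphs.

(* Main.v *)
(* Let p be a longest path missing some vertex. As in the Chvatal-Erdos
   argument, if a path outside p could be inserted between two vertices of p,
   then an outside vertex, the first vertex of p and the successors of the two
   attachment vertices would be four pairwise non-adjacent vertices. Hence the
   outside vertices form a clique attached to p at a single vertex x, so p and
   this clique are a path cover. Cutting p at x leaves two arms l and r; the
   same kind of argument shows that both are cliques and that an edge between
   them can only join the unique neighbours y, z of x in l and r. Either there
   is no such edge, and G - x has three components, or x, y, z form a triangle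
   of articulation points. Conversely, a vertex of a Hamiltonian path cuts it
   into at most two connected pieces, and in a triangle the vertex lying between
   the other two on the path does not disconnect the graph. *)
Require Import Defs.
From mathcomp Require Import all_boot zify.

Ltac perm_by_count :=
  (* [lia] blows up on the graph hypotheses. *)
  clear; try match goal with p := _ |- _ => subst p end;
  apply/permP=> ?; do 4! rewrite /= ?(count_cat, count_rev); lia.

Section Graph.

Set Implicit Arguments.
Unset Strict Implicit.
Unset Printing Implicit Defensive.

Variables (T : finType) (e : rel T).
Hypotheses (e_sym : symmetric e) (e_irr : irreflexive e).
Implicit Types (x y z u v h : T) (p q s l r : seq T) (A : {set T}).

(** * Counting components by invariants *)

Lemma induced_connect_sym A : connect_sym (induced e A).
Proof.
apply: sym_connect_sym => u v /=.
by rewrite /induced /= e_sym andbCA.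
Qed.

Lemma induced_connect_mem A u v :
  u \in A -> connect (induced e A) u v -> v \in A.
Proof.
move=> uA /connectP[s]; elim: s u uA => [|w s IHs] u uA /=.
  by move=> _ ->.
by case/andP=> /and3P[_ wA _]; apply: IHs.
Qed.

(** A map constant along edges is constant on components, so each of its values is already taken at
    a component root. *)
Lemma card_image_le_components (rT : finType) (f : T -> rT) A :
    {in A &, forall u v, e u v -> f u = f v} ->
  #|f @: A| <= num_components e A.
Proof.
move=> f_edge; have symA := induced_connect_sym A.
have f_connect u v : connect (induced e A) u v -> f u = f v.
  case/connectP=> s; elim: s u => [|w s IHs] u /=; first by move=> _ ->.
  by case/andP=> /and3P[uA wA /f_edge->] // /IHs; apply.
apply: leq_trans (leq_imset_card f (predI (roots (induced e A)) (mem A))).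
apply/subset_leq_card/subsetP=> _ /imsetP[u uA ->].
rewrite (f_connect _ _ (connect_root _ u)); apply: imset_f.
by rewrite inE /= roots_root // (induced_connect_mem uA) ?connect_root.
Qed.

(** The hypothesis makes [f] injective on component roots. *)
Lemma components_le_card (rT : finType) (f : T -> rT) A :
    {in A &, forall u v, f u = f v -> connect (induced e A) u v} ->
  num_components e A <= #|rT|.
Proof.
move=> f_connect; have symA := induced_connect_sym A.
rewrite /num_components /n_comp_mem -(@card_in_imset _ _ f) ?max_card //.
move=> u v /andP[/eqP uR uA] /andP[/eqP vR vA] /f_connect.
by move=> /(_ uA vA) /(rootP symA); rewrite uR vR.
Qed.

(** Otherwise [P] would be constant along edges while taking both values, which forces two
    components. *)
Lemma crossing_edge (P : pred T) u v :
    connected_graph e -> P u -> ~~ P v ->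
  exists2 x, P x & exists2 h, ~~ P h & e x h.
Proof.
move=> conn Pu Pv; case: (boolP [exists x, exists h, [&& P x, ~~ P h & e x h]]).
  by case/existsP=> x /existsP[h /and3P[? ? ?]]; exists x; last exists h.
move=> noE; have noP x y : P x -> e x y -> P y.
  move=> Px xy; apply: contraR noE => Py.
  by apply/existsP; exists x; apply/existsP; exists y; rewrite Px Py xy.
have : #|P @: [set: T]| <= num_components e [set: T].
  apply: card_image_le_components => x y _ _ xy.
  by apply/idP/idP => /noP; apply; rewrite // e_sym.
have sub2 : [set true; false] \subset P @: [set: T].
  by apply/subsetP=> _ /set2P[]->; rewrite -?{1}Pu -?(negbTE Pv) imset_f.
by rewrite conn => /(leq_trans (subset_leq_card sub2)); rewrite cards2.
Qed.

(** * Paths, cliques and longest paths *)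

Lemma sorted_rev s : sorted e (rev s) = sorted e s.
Proof. by rewrite rev_sorted; apply: eq_sorted => u v; rewrite e_sym. Qed.

Lemma sorted_arms l x r :
  sorted e (rev l ++ x :: r) = path e x l && path e x r.
Proof.
by rewrite sorted_cat_cons -rev_cons sorted_rev.
Qed.

Definition clique s := {in s &, forall u v, u != v -> e u v}.

Lemma clique_sorted s q : clique s -> {subset q <= s} -> uniq q -> sorted e q.
Proof.
move=> cl_s sub_q; rewrite uniq_pairwise => q_uniq.
apply: pairwise_sorted; apply: (sub_in_pairwise (P := mem s)) q_uniq.
  by move=> u v us vs /=; apply: cl_s.
by apply/allP.
Qed.

Definition longest p :=
  [/\ uniq p, sorted e p &
      forall q, uniq q -> sorted e q -> size q <= size p].

Lemma longest_exists : exists p, longest p.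
Proof.
pose P n := [exists t : n.-tuple T, uniq t && sorted e t].
have P0 : exists n, P n by exists 0; apply/existsP; exists [tuple].
have P_le n : P n -> n <= #|T|.
  case/existsP=> t /andP[/card_uniqP tU _].
  by rewrite -(size_tuple t) -tU max_card.
case: (ex_maxnP P0 P_le) => n /existsP[t /andP[tU tS]] n_max.
exists t; split=> // q qU qS; rewrite size_tuple; apply: n_max.
by apply/existsP; exists (in_tuple q); rewrite qU qS.
Qed.

Lemma longest_rev p : longest p -> longest (rev p).
Proof.
by case=> ? ? ?; split; rewrite ?rev_uniq ?sorted_rev ?size_rev.
Qed.

(** Rerouting arguments end here: [s] is the new path, and giving its vertices by [perm_eq] leaves a
    goal that counting settles. *)
Lemma longest_not_extendable p q s :
    longest p -> q != [::] -> uniq q -> {in q, forall h, h \notin p} ->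
  perm_eq s (q ++ p) -> sorted e s -> False.
Proof.
case=> pU _ p_max q0 qU q_p perm_s sS.
have: size s <= size p.
  apply: p_max sS; rewrite (perm_uniq perm_s) cat_uniq qU pU andbT /=.
  by apply/hasPn=> u up; apply/negP => /q_p; rewrite up.
by rewrite (perm_size perm_s) size_cat; case: q q0 {qU q_p perm_s}=> //= *; lia.
Qed.

(** * Attachments of outside paths to a longest path *)

Hypothesis e_4K1 : fourK1_free e.

Lemma no_stable4 a b c d :
  ~ pairwise (fun u v => (u != v) && ~~ e u v) [:: a; b; c; d].
Proof.
pose s := [:: a; b; c; d]; move=> st; apply: e_4K1; exists [set u in s].
  rewrite cardsE; apply/card_uniqP; rewrite uniq_pairwise.
  by apply: sub_pairwise st => u v /andP[].
move: st => /=; rewrite !andbT => /and3P[/and3P[]].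
move=> /andP[_ ab] /andP[_ ac] /andP[_ ad].
move=> /andP[/andP[_ bc] /andP[_ bd]] /andP[_ cd].
by move=> u v; rewrite !inE => /or4P[]/eqP-> /or4P[]/eqP->;
   rewrite ?e_irr // e_sym.
Qed.


Lemma path_rcons_rev x s y :
  path e x (rcons s y) = path e y (rcons (rev s) x).
Proof.
rewrite -[LHS]/(sorted e (x :: rcons s y)) -sorted_rev rev_cons rev_rcons.
by [].
Qed.

(** An empty [l], [m] or [r] gives a longer path at once. Otherwise four vertices are stable, since
    each of the six possible edges reroutes [p] through one end of [q] or through all of [q]. *)
Lemma longest_attach_ordered l x m x' r q :
    longest (rev l ++ x :: m ++ x' :: r) -> q != [::] -> uniq q ->
    {in q, forall h, h \notin rev l ++ x :: m ++ x' :: r} ->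
  path e x (rcons q x') -> False.
Proof.
set p := rev l ++ _; move=> lp; case: q => [|h q] // _ qU q_p Pq.
have [pU pS _] := lp.
have no_ext := longest_not_extendable lp.
have h_p : h \notin p by apply: q_p; rewrite mem_head.
have h'_p : last h q \notin p by apply/q_p/mem_last.
have no_ext1 u s : u \notin p -> perm_eq s (u :: p) -> ~ sorted e s.
  move=> u_p perm_s; apply: (no_ext [:: u]) => //.
  by move=> w; rewrite inE => /eqP->.
have no_extq s : perm_eq s ((h :: q) ++ p) -> ~ sorted e s by apply: no_ext.
move: pS; rewrite sorted_arms -cat_rcons cat_path last_rcons.
move=> /and3P[Pl Pm Pr].
have Pq' : path e x' (rcons (rev (h :: q)) x) by rewrite -path_rcons_rev.
have Pm' : path e x' (rcons (rev m) x) by rewrite -path_rcons_rev.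
have xh : e x h by move: Pq => /= /andP[].
have x'h' : e x' (last h q).
  by move: Pq'; rewrite lastI rev_rcons /= => /andP[].
(* With [m] empty, [q] fits between [x] and [x']; with [r] or [l] empty, an end of [q] prolongs
   [p]. *)
case: m => [|m1 m] in p lp pU q_p no_ext h_p h'_p no_ext1 no_extq Pm Pm' *.
  apply: (no_extq (rev l ++ x :: (h :: q) ++ x' :: r)); first by perm_by_count.
  by rewrite sorted_arms Pl -cat_rcons cat_path Pq last_rcons.
case: r => [|r1 r] in p lp pU q_p no_ext h_p h'_p no_ext1 no_extq Pr *.
  apply: (no_ext1 (last h q)
    (rev l ++ x :: rcons (m1 :: m) x' ++ [:: last h q])) => //.
    by rewrite -cats1; perm_by_count.
  by rewrite sorted_arms Pl cat_path Pm last_rcons /= x'h'.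
have Pmr : path e x ((m1 :: m) ++ x' :: r1 :: r).
  by rewrite -cat_rcons cat_path Pm last_rcons.
case: l => [|l1 l] in p lp pU q_p no_ext h_p h'_p no_ext1 no_extq Pl *.
  apply: (no_ext1 h (h :: p)) => //.
  by rewrite /p /= e_sym xh.
have [Pm_ Em] : path e x (m1 :: m) /\ e (last m1 m) x'.
  by move: Pm; rewrite rcons_path => /andP[].
pose a := last l1 l.
have a_p : a \in rev (l1 :: l) by rewrite mem_rev mem_last.
have h_neq u : u \in p -> h != u.
  by move=> up; apply: contraNneq h_p => ->.
have a_in : a \in p by rewrite mem_cat a_p.
have m1_in : m1 \in p by rewrite !(mem_cat, inE) eqxx !orbT.
have r1_in : r1 \in p by rewrite !(mem_cat, inE) eqxx !orbT.
have a_neq u : u \in x :: (m1 :: m) ++ x' :: r1 :: r -> a != u.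
  move=> u_in; apply: contraTneq u_in => <-.
  move: pU; rewrite cat_uniq => /and3P[_ /hasPn/(_ a) pU _].
  exact: contraL a_p.
have m1r1 : m1 != r1.
  move: pU; rewrite cat_uniq /= mem_cat !inE => /and5P[_ _ _ + _].
  by apply: contraNneq => ->; rewrite eqxx !orbT.
(* Stable: [h], the endpoint [a], and the successors of [x] and [x']. *)
apply: (@no_stable4 h a m1 r1).
rewrite /= !h_neq ?m1r1 ?a_neq // ?(mem_cat, inE, eqxx, orbT) //=.
rewrite !andbT; apply/and3P; split; [apply/and3P; split | apply/andP; split | ].
- apply/negP=> ha.
  apply: (no_ext1 h
    (rev ((m1 :: m) ++ x' :: r1 :: r) ++ x :: rcons (l1 :: l) h)) => //.
    by rewrite -cats1; perm_by_count.
  by rewrite sorted_arms rcons_path Pl Pmr /= e_sym ha.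
- apply/negP=> hm1.
  apply: (no_ext1 h
    (rev (l1 :: l) ++ x :: h :: (m1 :: m) ++ x' :: r1 :: r)) => //.
    by perm_by_count.
  rewrite sorted_arms Pl /= xh hm1 /=.
  by move: Pm_ => /= /andP[_]; rewrite cat_path /= => ->; rewrite Em.
- apply/negP=> hr1.
  apply: (no_extq (rev (l1 :: l) ++
    x :: rcons (m1 :: m) x' ++ rev (h :: q) ++ r1 :: r)).
    by rewrite -cats1; perm_by_count.
  rewrite sorted_arms Pl cat_path Pm last_rcons cat_path.
  move: Pq'; rewrite rcons_path => /andP[-> _] /=.
  by rewrite rev_cons last_rcons hr1; move: Pr => /= /andP[].
- apply/negP=> am1.
  apply: (no_ext1 h (h :: x :: (l1 :: l) ++ (m1 :: m) ++ x' :: r1 :: r)) => //.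
    by perm_by_count.
  rewrite /= e_sym xh /=; move: Pl => /= /andP[-> Pl] /=.
  rewrite cat_path Pl /= am1 /=.
  by move: Pm_ => /= /andP[_]; rewrite cat_path /= => ->; rewrite Em.
(* The new path enters [p] at [x'], runs backwards all the way to [a], and jumps to [r1]. *)
- apply/negP=> ar1.
  apply: (no_ext1 (last h q) (last h q ::
    x' :: rcons (rev (m1 :: m)) x ++ (l1 :: l) ++ r1 :: r)) => //.
    by rewrite -cats1; perm_by_count.
  rewrite /= e_sym x'h' /= cat_path Pm' last_rcons -cat_cons cat_path Pl /=.
  by rewrite ar1; move: Pr => /= /andP[].
(* The new path takes [q] from [x] to [x'], runs backwards to [m1], and jumps to [r1]. *)
apply/negP=> mr.
apply: (no_extq (rev (l1 :: l) ++
  x :: rcons (h :: q) x' ++ rev (m1 :: m) ++ r1 :: r)).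
  by rewrite -cats1; perm_by_count.
rewrite sorted_arms Pl cat_path Pq last_rcons cat_path.
move: Pm'; rewrite rcons_path => /andP[-> _] /=.
by rewrite rev_cons last_rcons mr; move: Pr => /= /andP[].
Qed.

(** The two attachment vertices may occur on [p] in either order; if [x'] comes first, [q] is
    reversed. *)
Lemma longest_attach p q x x' :
    longest p -> q != [::] -> uniq q -> {in q, forall h, h \notin p} ->
    x \in p -> x' \in p -> path e x (rcons q x') ->
  x = x'.
Proof.
move=> lp q0 qU q_p xp x'p Pq; apply/eqP/negP=> xx'.
case/splitPr: xp => l r in lp q_p x'p; rewrite -[l]revK in lp q_p x'p.
move: x'p; rewrite mem_cat inE eq_sym => /or3P[|/idP//|].
  rewrite mem_rev => /splitPr Hl; case: Hl lp q_p => m l2 lp q_p.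
  move: lp q_p; rewrite rev_cat rev_cons cat_rcons -catA cat_cons => lp q_p.
  apply: (longest_attach_ordered (q := rev q) lp); rewrite ?rev_uniq //.
  - by rewrite -size_eq0 size_rev size_eq0.
  - by move=> u; rewrite mem_rev => /q_p.
  by rewrite -path_rcons_rev.
move=> /splitPr Hr; case: Hr lp q_p => m r2 lp q_p.
exact: longest_attach_ordered lp q0 qU q_p Pq.
Qed.

(** * Basic facts on spiders *)

(* A longest path seen from its attachment vertex [x]: both arms [l] and [r]
   are listed from [x] outwards, so that the situation is symmetric. *)
Definition spider x l r h :=
  [/\ longest (rev l ++ x :: r), h \notin rev l ++ x :: r & e x h].

Lemma spiderC x l r h : spider x l r h -> spider x r l h.
Proof.
have revE : rev (rev l ++ x :: r) = rev r ++ x :: l.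
  by rewrite rev_cat rev_cons revK cat_rcons.
by case=> /longest_rev lp hp xh; split; rewrite -?revE ?mem_rev.
Qed.

Lemma spider_exists p x h :
    longest p -> x \in p -> h \notin p -> e x h ->
  exists l r, p = rev l ++ x :: r /\ spider x l r h.
Proof.
move=> lp /splitPr Hp; case: Hp lp => l r lp hp xh.
by exists (rev l), r; rewrite /spider revK.
Qed.

Lemma spider_uniq x l r h :
  spider x l r h -> (x \notin l ++ r) /\ uniq (l ++ r).
Proof.
case=> -[pU _ _] _ _; apply/andP; rewrite -cons_uniq.
rewrite (perm_uniq (_ : perm_eq _ (rev l ++ x :: r))) //.
by perm_by_count.
Qed.

(** [h], [x] and then [s] would be a longer path. So an edge is refuted once it helps to traverse
    both arms from [x]. *)
Lemma spider_no_path x l r h s :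
  spider x l r h -> perm_eq s (l ++ r) -> ~ path e x s.
Proof.
move=> [lp hp xh] perm_s xs.
apply: (@longest_not_extendable _ [:: h] (h :: x :: s) lp) => //.
- by move=> u; rewrite inE => /eqP->.
- rewrite /= perm_cons (perm_trans (_ : perm_eq _ (x :: l ++ r))) ?perm_cons //.
  by perm_by_count.
by rewrite /= e_sym xh.
Qed.

(** Otherwise [h] could be appended after [last x l], which is [x] itself when [l] is empty. No edge
    from [x] to [h] is assumed, so this covers every outside vertex. *)
Lemma longest_end x l r h :
    longest (rev l ++ x :: r) -> h \notin rev l ++ x :: r ->
  ~~ e h (last x l).
Proof.
move=> lp hp; apply/negP=> hl.
apply: (@longest_not_extendable _ [:: h] (rev r ++ x :: rcons l h) lp) => //.
- by move=> u; rewrite inE => /eqP->.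
- by rewrite -cats1; perm_by_count.
case: lp => _ + _; rewrite !sorted_arms rcons_path => /andP[-> ->] /=.
by rewrite e_sym hl.
Qed.

(** This expresses that arms are nonempty: with [l] empty, [x] would be an end of the longest path
    adjacent to [h]. *)
Lemma spider_last x l r h : spider x l r h -> last x l \in l.
Proof.
case: l => [|y l] [lp hp xh]; last by rewrite /= mem_last.
by have := longest_end lp hp; rewrite e_sym xh.
Qed.

Lemma spider_paths x l r h : spider x l r h -> path e x l /\ path e x r.
Proof. by case=> -[_ pS _] _ _; apply/andP; rewrite -sorted_arms. Qed.

Lemma spider_neighbor x l r h : spider x l r h -> exists2 y, y \in l & e x y.
Proof.
move=> sp; have := spider_last sp; have [xl _] := spider_paths sp.
by case: l xl {sp} => // y l /= /andP[xy _] _; exists y; rewrite ?mem_head.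
Qed.

Lemma spider_attach x l r h u :
  spider x l r h -> u \in rev l ++ x :: r -> e h u -> u = x.
Proof.
move=> [lp hp xh] up hu; apply/esym.
apply: (@longest_attach _ [:: h] _ _ lp) => //.
- by move=> v; rewrite inE => /eqP->.
- by rewrite mem_cat mem_head orbT.
by rewrite /= xh hu.
Qed.

Lemma spider_neq x l r h u v : spider x l r h -> u \in l -> v \in r -> u != v.
Proof.
move=> /spider_uniq[_]; rewrite cat_uniq => /and3P[_ /hasPn lr _] ul vr.
by apply: contraNneq (lr _ vr) => <-.
Qed.

Lemma spider_center x l r h u : spider x l r h -> u \in l ++ r -> u != x.
Proof.
by move=> /spider_uniq[xlr _] ulr; apply: contraNneq xlr => <-.
Qed.

Lemma spider_mem x l r u :
  (u \in rev l ++ x :: r) = [|| u == x, u \in l | u \in r].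
Proof. by rewrite mem_cat mem_rev inE orbCA. Qed.

Lemma spider_memC x l r u :
  (u \in rev l ++ x :: r) = (u \in rev r ++ x :: l).
Proof. by rewrite !spider_mem [(u \in l) || _]orbC. Qed.

Lemma spider_head_last x l z r h : spider x l (z :: r) h -> ~~ e (last x l) z.
Proof.
move=> sp; have [xl /= /andP[_ zr]] := spider_paths sp.
apply/negP=> lz; apply: (spider_no_path sp (perm_refl _)).
by rewrite cat_path xl /= lz zr.
Qed.

(** * Vertices outside the longest path *)

(** If [h] and [h'] were non-adjacent, [h'] would see the head of each arm, since otherwise [h],
    [h'], that head and the end of the other arm are stable. Two attachment vertices contradict
    [longest_attach]. *)
Lemma outside_adjacent x l r h h' :
    spider x l r h -> h' \notin rev l ++ x :: r -> h' != h ->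
  e h h'.
Proof.
move=> sp h'p h'h; have [lp hp xh] := sp; have spC := spiderC sp.
have al := spider_last sp; have br := spider_last spC.
case: l => [|y l] // in sp lp hp spC h'p al *.
case: r => [|z r] // in sp lp hp spC h'p br *.
have hz m v n : spider x m (v :: n) h -> h' \notin rev m ++ x :: v :: n ->
  ~~ e h h' -> e h' v.
  move=> {}sp {}h'p nhh'; have [{}lp {}hp _] := sp.
  have am := spider_last sp.
  have vn : v \in v :: n by rewrite mem_head.
  apply: contraT => h'v; case: (@no_stable4 h h' (last x m) v).
  have hv : ~~ e h v.
    have vx : v != x by rewrite (spider_center sp) // mem_cat vn orbT.
    apply: contraNN vx => /(spider_attach sp)-> //.
    by rewrite spider_mem vn !orbT.
  have nm u : u \in m \/ u = v -> (h != u) && (h' != u).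
    move=> um; have up : u \in rev m ++ x :: v :: n.
      by rewrite spider_mem; case: um => ->; rewrite ?mem_head ?orbT.
    by rewrite !(memPnC _ _ up).
  have /andP[ha h'a] := nm _ (or_introl am).
  have /andP[hv' h'v'] := nm _ (or_intror erefl).
  rewrite /= ha h'a hv' h'v' hv h'v nhh' (eq_sym h) h'h.
  rewrite (negbTE (longest_end lp hp)) (negbTE (longest_end lp h'p)) /=.
  by rewrite (spider_neq sp) // (spider_head_last sp).
apply: contraT => nhh'.
have h'z := hz _ _ _ sp h'p nhh'.
have h'y : e h' y by apply: (hz _ _ _ spC) => //; rewrite spider_memC.
have /eqP[] : y != z by rewrite (spider_neq sp) // mem_head.
apply: (@longest_attach _ [:: h'] _ _ lp) => //.
- by move=> v; rewrite inE => /eqP->.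
- by rewrite spider_mem mem_head orbT.
- by rewrite spider_mem mem_head !orbT.
by rewrite /= e_sym h'y h'z.
Qed.

Lemma outside_attach x l r h h' u :
    spider x l r h -> h' \notin rev l ++ x :: r -> u \in rev l ++ x :: r ->
  e h' u -> u = x.
Proof.
move=> sp h'p up; have [->|h'h] := eqVneq h' h.
  exact: spider_attach sp up.
move=> h'u; have [lp hp xh] := sp; apply/esym.
apply: (@longest_attach _ [:: h; h'] _ _ lp) => //.
- by rewrite /= inE eq_sym h'h.
- by move=> v; rewrite !inE => /orP[] /eqP->.
- by rewrite spider_mem eqxx.
by rewrite /= xh h'u (outside_adjacent sp).
Qed.

(** Two non-adjacent outside vertices would be stable together with the end of [l] and the head of
    [r]. *)
Lemma outside_clique x l r h u v :
    spider x l r h -> u \notin rev l ++ x :: r -> v \notin rev l ++ x :: r ->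
  u != v -> e u v.
Proof.
move=> sp up vp uv; have [lp hp xh] := sp; apply: contraT => nuv.
have al := spider_last sp; have br := spider_last (spiderC sp).
case: r => [|z r] // in sp lp hp up vp br *.
have zP : z \in rev l ++ x :: z :: r by rewrite spider_mem mem_head !orbT.
have aP : last x l \in rev l ++ x :: z :: r by rewrite spider_mem al orbT.
have zx : z != x by rewrite (spider_center sp) // mem_cat mem_head orbT.
have nz w : w \notin rev l ++ x :: z :: r -> ~~ e w z.
  by move=> wp; apply: contraNN zx => /(outside_attach sp wp zP)->.
have neq w w' : w \notin rev l ++ x :: z :: r ->
    w' \in rev l ++ x :: z :: r -> w != w'.
  by move=> wp w'p; apply: contraNneq wp => ->.
case: (@no_stable4 u v (last x l) z).
rewrite /= uv nuv !(neq u) // !(neq v) // !(nz u) // !(nz v) //.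
rewrite (negbTE (longest_end lp up)).
rewrite (negbTE (longest_end lp vp)) (spider_neq sp) ?mem_head //=.
by rewrite (spider_head_last sp).
Qed.

(** * The arms and the edges between them *)

(** Such an edge lets a path from [x] run through [l], jump to [u], follow [r] to its end and return
    to the head of [r]. The return edge exists, since otherwise [h], both ends and that head are
    stable. *)
Lemma spider_last_nonadj x l r h u :
  spider x l r h -> u \in r -> ~~ e (last x l) u.
Proof.
move=> sp ur; have [lp hp xh] := sp; have spC := spiderC sp.
have al := spider_last sp; have br := spider_last spC.
have [xl xr] := spider_paths sp.
have aP : last x l \in rev l ++ x :: r by rewrite spider_mem al orbT.
(* If the two ends were adjacent, [l] outwards and then [r] inwards would be a path from [x]. *)
have nab : ~~ e (last x l) (last x r).
  apply/negP=> ab; apply: (spider_no_path (s := l ++ rev r) sp).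
    by perm_by_count.
  rewrite cat_path xl /=; case/lastP: r {br sp lp hp aP spC ur} xr ab => // r b.
  rewrite last_rcons rev_rcons /= => xr ->.
  rewrite -[path _ _ _]/(sorted e (b :: rev r)) -rev_rcons sorted_rev.
  by case: r xr => //= ? ? /andP[].
have [r1 [r2 er]] : exists r1 r2, r = r1 ++ u :: r2.
  by case/splitPr: ur => r1 r2; exists r1, r2.
apply/negP=> au; apply: (spider_no_path (s := l ++ (u :: r2) ++ r1) sp).
  by rewrite er; perm_by_count.
have [xr1 r1u ur2] : [/\ path e x r1, e (last x r1) u & path e u r2].
  by move: xr; rewrite er cat_path => /and3P.
rewrite cat_path xl /= au cat_path ur2 /=.
case: r1 => [|z r1] // in er xr1 r1u *; move: xr1 => /= /andP[xz zr1].
rewrite zr1 andbT.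
have bE : last x r = last u r2 by rewrite er last_cat.
(* When the far end of [r] sees its head, [r] can be traversed from [u]. *)
rewrite -bE; apply: contraT => nbz.
have zr : z \in r by rewrite er mem_head.
have bz : last x r != z.
  have [_] := spider_uniq sp; rewrite cat_uniq => /and3P[_ _].
  rewrite er cat_uniq => /and3P[_ /hasPn/(_ (last u r2)) dis _].
  move: (dis (mem_last _ _)); rewrite -er bE.
  by apply: contraNneq => ->; rewrite mem_head.
have zx : z != x by rewrite (spider_center sp) // mem_cat zr orbT.
have hz : ~~ e h z.
  apply: contraNN zx => /(spider_attach sp)-> //.
  by rewrite spider_mem zr !orbT.
have az : ~~ e (last x l) z.
  by move: sp; rewrite er; apply: spider_head_last.
have neq w : w \in rev l ++ x :: r -> h != w.
  by move=> wp; apply: contraNneq hp => ->.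
case: (@no_stable4 h (last x l) (last x r) z).
case: spC => lpC hpC _.
rewrite /= !neq ?spider_mem ?al ?zr ?br ?orbT // nab bz nbz hz az.
by rewrite (longest_end lp hp) (longest_end lpC hpC) !(spider_neq sp).
Qed.

(** Two non-adjacent vertices of [r] would be stable together with [h] and the end of [l]. By
    [spiderC] this serves for [l] too. *)
Lemma spider_clique x l r h : spider x l r h -> clique r.
Proof.
move=> sp u v ur vr uv; apply: contraT => nuv.
have [lp hp xh] := sp; have al := spider_last sp.
have hN w : w \in l ++ r -> (h != w) && ~~ e h w.
  move=> wlr; have wp : w \in rev l ++ x :: r.
    by rewrite spider_mem -mem_cat wlr orbT.
  apply/andP; split; first by apply: contraNneq hp => ->.
  apply: contraNN (spider_center sp wlr) => /(spider_attach sp wp)->.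
  by rewrite eqxx.
case: (@no_stable4 h (last x l) u v).
by rewrite /= !hN ?mem_cat ?al ?ur ?vr ?orbT // uv nuv
  !(spider_neq sp) // !(spider_last_nonadj sp).
Qed.

(** If [y] were not [u], a path from [x] could traverse the clique [l] from [y] to [u], then the
    clique [r] from [v]. Since [x] has a neighbour in [l], all cross edges share their end there. *)
Lemma spider_cross_neighbor x l r h u v y :
    spider x l r h -> u \in l -> v \in r -> e u v -> y \in l -> e x y ->
  y = u.
Proof.
move=> sp ul vr uv yl xy; apply/eqP; apply: contraT => yu.
have cl_r := spider_clique sp; have cl_l := spider_clique (spiderC sp).
have [_] := spider_uniq sp; rewrite cat_uniq => /and3P[lU _ rU].
have url : u \in rem y l by rewrite mem_rem_uniq // !inE eq_sym yu.
have perm_l := perm_to_rem yl; have perm_yl := perm_to_rem url.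
have perm_r := perm_to_rem vr.
have perm_l' : perm_eq (y :: rcons (rem u (rem y l)) u) l.
  rewrite perm_sym (perm_trans perm_l) // perm_cons (perm_trans perm_yl) //.
  by rewrite perm_sym perm_rcons.
exfalso; apply: (spider_no_path
  (s := (y :: rcons (rem u (rem y l)) u) ++ v :: rem v r) sp).
  by apply: perm_cat; rewrite // perm_sym.
have sl : sorted e (y :: rcons (rem u (rem y l)) u).
  apply: (clique_sorted cl_l); last by rewrite (perm_uniq perm_l').
  by move=> w; rewrite (perm_mem perm_l').
have sr : sorted e (v :: rem v r).
  apply: (clique_sorted cl_r); last by rewrite -(perm_uniq perm_r).
  by move=> w; rewrite -(perm_mem perm_r).
rewrite cat_path /= xy last_rcons uv; move: sl sr => /= -> ->.
by [].
Qed.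

(** If [l] were just [u], then [x], [u], [v] and the rest of the clique [r] would be a path. The
    vertex [w] is what removing [u] separates from [x]. *)
Lemma spider_cross_other x l r h u v :
    spider x l r h -> u \in l -> v \in r -> e u v ->
  exists2 w, w \in l & w != u.
Proof.
move=> sp ul vr uv; have cl_r := spider_clique sp.
have [_] := spider_uniq sp; rewrite cat_uniq => /and3P[lU _ rU].
case: l => [|y l] // in sp ul lU *.
have xy : e x y by case: (spider_paths sp) => /= /andP[].
have yE := spider_cross_neighbor sp ul vr uv (mem_head _ _) xy.
case: l => [|w l] in sp ul lU yE *; last first.
  exists w; first by rewrite !inE eqxx orbT.
  by move: lU; rewrite /= !inE !negb_or -yE eq_sym => /andP[/andP[]].
have perm_r := perm_to_rem vr.
exfalso; apply: (spider_no_path (s := y :: v :: rem v r) sp).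
  by rewrite /= perm_cons perm_sym.
have sr : sorted e (v :: rem v r).
  apply: (clique_sorted cl_r); last by rewrite -(perm_uniq perm_r).
  by move=> w; rewrite -(perm_mem perm_r).
by move: sr => /= ->; rewrite xy yE uv.
Qed.

(** * Articulation points and components at a spider *)

(** [P] is an invariant separating [u] from [v] once [x] is removed; closure in one direction
    suffices because [e] is symmetric. *)
Lemma articulationI (P : pred T) x u v :
    u != x -> v != x -> P u -> ~~ P v ->
    (forall w w', w != x -> w' != x -> P w -> e w w' -> P w') ->
  articulation e x.
Proof.
move=> ux vx Pu Pv P_edge; rewrite /articulation.
have sub2 : [set true; false] \subset P @: [set~ x].
  by apply/subsetP=> _ /set2P[]->; rewrite -?{1}Pu -?(negbTE Pv) imset_f ?inE.
rewrite (leq_trans _ (card_image_le_components (f := P) _)) //.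
  by rewrite (leq_trans _ (subset_leq_card sub2)) ?cards2.
move=> w w'; rewrite !inE => wx w'x ww'.
by apply/idP/idP=> Pw; [apply: (P_edge w) | apply: (P_edge w')];
   rewrite // e_sym.
Qed.

(** Removing [u] cuts off the rest of [l]: outside vertices meet the path only in [x], [x] sees only
    [u] in [l], and every cross edge ends at [u]. *)
Lemma spider_cross_articulation x l r h u v :
  spider x l r h -> u \in l -> v \in r -> e u v -> articulation e u.
Proof.
move=> sp ul vr uv; have [w wl wu] := spider_cross_other sp ul vr uv.
have xE : x \notin l.
  apply/negP=> xl; have := spider_center sp (_ : x \in l ++ r).
  by rewrite mem_cat xl eqxx => /(_ isT).
have xu : x != u by apply: contraNneq xE => ->.
apply: (@articulationI (mem l) _ w x) => //= {wl wu}w w' wu w'u wl ww'.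
have wx : w != x by apply: contraNneq xE => <-.
have wp : w \in rev l ++ x :: r by rewrite spider_mem wl orbT.
case: (boolP (w' \in rev l ++ x :: r)); last first.
  move=> w'p; case/eqP: wx; apply: (outside_attach sp w'p wp).
  by rewrite e_sym.
rewrite spider_mem => /or3P[/eqP w'x|//|w'r].
  case/eqP: wu; apply: (spider_cross_neighbor sp ul vr uv wl).
  by rewrite e_sym -w'x.
have [y yl xy] := spider_neighbor sp.
case/eqP: wu; rewrite -(spider_cross_neighbor sp ul vr uv yl xy).
by rewrite -(spider_cross_neighbor sp wl w'r ww' yl xy).
Qed.

Lemma spider_articulation x l r h : spider x l r h -> articulation e x.
Proof.
move=> sp; have [_ hp xh] := sp; have al := spider_last sp.
have hx : h != x by apply: contraTneq xh => ->; rewrite e_irr.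
have ax : last x l != x by rewrite (spider_center sp) // mem_cat al.
have aP : last x l \in rev l ++ x :: r by rewrite spider_mem al orbT.
apply: (articulationI (P := [pred u | u \notin rev l ++ x :: r]) hx ax).
- exact: hp.
- by rewrite /= aP.
move=> w w' _ w'x /= wp ww'; apply: contraNN w'x => w'p.
by rewrite (outside_attach sp wp w'p ww').
Qed.

(** Membership in [l] and in [r] is constant along edges avoiding [x], and takes three values: at
    the two ends and at [h]. *)
Lemma spider_three_components x l r h :
    spider x l r h -> {in l & r, forall u v, ~~ e u v} ->
  2 < num_components e [set~ x].
Proof.
move=> sp lr; have [_ hp xh] := sp; have spC := spiderC sp.
have al := spider_last sp; have br := spider_last spC.
pose f u := (u \in l, u \in r).
have lrF u : u \in l -> u \in r -> false.
  by move=> ul ur; have /eqP[] := spider_neq sp ul ur.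
have closed_edge w w' : w != x -> w' != x -> e w w' ->
    ((w \in l) -> (w' \in l)) /\ ((w \in r) -> (w' \in r)).
  move=> wx w'x ww'.
  have [w'p|w'p] := boolP (w' \in rev l ++ x :: r); last first.
    by split=> wlr; case/eqP: wx; apply: (outside_attach sp w'p);
       rewrite 1?e_sym // spider_mem wlr !orbT.
  move: w'p; rewrite spider_mem (negbTE w'x) /= => /orP[] w'lr;
    split=> // wlr; exfalso.
    by move: (lr _ _ w'lr wlr); rewrite e_sym ww'.
  by move: (lr _ _ wlr w'lr); rewrite ww'.
have f_edge : {in [set~ x] &, forall u v, e u v -> f u = f v}.
  move=> u v; rewrite !inE => ux vx uv.
  have [ul ur] := closed_edge u v ux vx uv.
  have [|vl vr] := closed_edge v u vx ux; first by rewrite e_sym.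
  by congr pair; apply/idP/idP.
apply: leq_trans (card_image_le_components f_edge).
have uniq3 : uniq [:: (true, false); (false, true); (false, false)] by [].
rewrite -[3]/(size [:: (true, false); (false, true); (false, false)]).
rewrite -(card_uniqP uniq3); apply/subset_leq_card/subsetP=> b.
rewrite spider_mem !negb_or in hp; case/and3P: hp => hx hl hr.
rewrite !inE => /or3P[] /eqP->; apply/imsetP.
- exists (last x l); first by rewrite !inE (spider_center sp) // mem_cat al.
  by rewrite /f al; case: (boolP (_ \in r)) => // /(lrF _ al).
- exists (last x r).
    by rewrite !inE (spider_center sp) // mem_cat br orbT.
  by rewrite /f br; case: (boolP (_ \in l)) => // /lrF/(_ br).
exists h; first by rewrite !inE.
by rewrite /f (negbTE hl) (negbTE hr).
Qed.

Lemma spider_triangle x l r h :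
    spider x l r h -> num_components e [set~ x] = 2 ->
  exists y z : T,
    [/\ articulation e x, articulation e y & articulation e z] /\
    [/\ e x y, e y z & e x z].
Proof.
move=> sp comp2; have spC := spiderC sp.
have [/hasP[u ul /hasP[v vr uv]]|no_edge] :=
  boolP (has (fun u => has (e u) r) l).
  have vu : e v u by rewrite e_sym.
  have [y yl xy] := spider_neighbor sp; have [z zr xz] := spider_neighbor spC.
  exists u, v; split.
    split; [exact: spider_articulation sp | |].
      exact: spider_cross_articulation sp ul vr uv.
    exact: spider_cross_articulation spC vr ul vu.
  (* The neighbours [y], [z] of [x] are forced to be [u], [v], which closes the triangle. *)
  by rewrite -{1}(spider_cross_neighbor sp ul vr uv yl xy)
     -{2}(spider_cross_neighbor spC vr ul vu zr xz).
have := spider_three_components sp; rewrite comp2 => three.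
exfalso; suff /three : {in l & r, forall u v, ~~ e u v} by [].
by move=> u v ul vr; move/hasPn: no_edge => /(_ u ul)/hasPn/(_ v vr).
Qed.

(** * The dichotomy and the path cover *)

(** If a longest path misses a vertex, connectedness gives an edge leaving it, which serves as the
    edge from [x] to [h]. *)
Lemma hamiltonian_or_spider :
    connected_graph e ->
  has_hamiltonian_path e \/ exists x l r h, spider x l r h.
Proof.
move=> conn; have [p lp] := longest_exists; have [pU pS p_max] := lp.
have p0 : p != [::].
  have : 0 < num_components e [set: T] by rewrite conn.
  rewrite /num_components /n_comp_mem => /card_gt0P[v _].
  by have := p_max [:: v] isT isT; case: (p).
have [/forallP p_all|] := boolP [forall v, v \in p].
  by left; exists p => //; rewrite /graph_path p0 pS.
rewrite negb_forall => /existsP[v vp]; right.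
have [u up] : exists u, u \in p.
  by case: (p) p0 => // u s _; exists u; rewrite mem_head.
have [x xp [h hp xh]] := crossing_edge (P := mem p) conn up vp.
have [l [r [_ sp]]] := spider_exists lp xp hp xh.
by exists x, l, r, h.
Qed.

(** The outside vertices form a clique, so any enumeration of them is a path; it is nonempty because
    of [h]. *)
Lemma spider_path_cover x l r h : spider x l r h -> has_path_cover e 2.
Proof.
move=> sp; have [[pU pS _] hp _] := sp; set p := rev l ++ x :: r in pU pS hp.
pose q := enum [pred u | u \notin p].
have q_p u : (u \in q) = (u \notin p) by rewrite mem_enum.
have cl_q : clique q.
  by move=> u v; rewrite !q_p => up vp; apply: outside_clique sp up vp.
exists [:: p; q]; split=> //=.
- rewrite /graph_path pU pS enum_uniq (clique_sorted cl_q) ?enum_uniq // !andbT.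
  apply/andP; split; first by rewrite /p; case: (rev l).
  by apply: contraTneq (hp) => q0; rewrite -q_p q0.
- by rewrite !andbT; apply/pred0P=> u /=; rewrite q_p andbN.
by move=> v; rewrite q_p orbF orbN.
Qed.

(** * Articulation points on a Hamiltonian path *)

Lemma sorted_induced_connect A s :
    sorted e s -> {subset s <= A} ->
  {in s &, forall u v, connect (induced e A) u v}.
Proof.
case: s => // w s ws sA.
have : path (induced e A) w s.
  elim: s w ws sA => //= t s IHs w /andP[wt ts] sA.
  rewrite {1}/induced /= !sA ?wt ?inE ?eqxx ?orbT //= IHs // => u us.
  by apply: sA; rewrite inE us orbT.
move=> /path_connect ws' u v /ws' wu /ws' wv.
by rewrite induced_connect_sym in wu; apply: connect_trans wu wv.
Qed.

Section HamiltonianPath.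

Variables (l r : seq T) (x : T).
Hypothesis p_path : graph_path e (l ++ x :: r).
Hypothesis p_all : forall v, v \in l ++ x :: r.

(** Each side of [x] is itself a path, and it avoids [x]. Here [l] is in path order, not listed from
    [x] outwards. *)
Lemma hamiltonian_arms_connect :
  {in l &, forall u v, connect (induced e [set~ x]) u v} /\
  {in r &, forall u v, connect (induced e [set~ x]) u v}.
Proof.
case/and3P: p_path => _ pS; rewrite uniq_catC cons_uniq mem_cat.
move=> /andP[/norP[xr xl] _]; have [lS xrS] := cat_sorted2 pS.
split; apply: sorted_induced_connect => //.
- by move=> u ul; rewrite !inE; apply: contraNneq xl => <-.
- exact: path_sorted xrS.
by move=> u ur; rewrite !inE; apply: contraNneq xr => <-.
Qed.

Lemma hamiltonian_notin u : u != x -> u \notin l -> u \in r.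
Proof.
by have := p_all u; rewrite mem_cat inE => /or3P[->|->|].
Qed.

Lemma hamiltonian_components : num_components e [set~ x] <= 2.
Proof.
have [lC rC] := hamiltonian_arms_connect.
rewrite -card_bool; apply: (components_le_card (f := fun u => u \in l)).
move=> u v; rewrite !inE => ux vx uv.
have [ul|ul] := boolP (u \in l); first by apply: lC; rewrite // -uv.
by apply: rC; apply: hamiltonian_notin; rewrite // -uv.
Qed.

(** The edge from [u] to [v] bypasses [x] and joins its two sides, leaving one component. *)
Lemma hamiltonian_not_articulation u v :
  u \in l -> v \in r -> e u v -> ~ articulation e x.
Proof.
move=> ul vr uv; apply/negP; rewrite -leqNgt.
have [lC rC] := hamiltonian_arms_connect.
have x_neq w : w \in l ++ r -> w != x.
  case/and3P: p_path => _ _; rewrite uniq_catC cons_uniq => /andP[xrl _].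
  by rewrite mem_cat orbC -mem_cat; apply: contraTneq => ->.
have uvC : connect (induced e [set~ x]) u v.
  apply: connect1.
  by rewrite /induced /= !inE uv !x_neq // mem_cat ?ul ?vr ?orbT.
have symC := induced_connect_sym [set~ x].
have uC w : w != x -> connect (induced e [set~ x]) u w.
  move=> wx; have [wl|wl] := boolP (w \in l); first exact: lC.
  by apply: (connect_trans uvC); apply: rC; rewrite // hamiltonian_notin.
rewrite -card_unit; apply: (components_le_card (f := fun=> tt)) => w w'.
by rewrite !inE => wx w'x _; apply: connect_trans (uC _ w'x); rewrite symC uC.
Qed.

End HamiltonianPath.

Lemma hamiltonian_between p u y v :
    graph_path e p -> (forall w, w \in p) -> index u p < index y p ->
    index y p < index v p -> e u v ->
  ~ articulation e y.
Proof.
move=> pP p_all; have pU : uniq p by case/and3P: pP.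
have yp := p_all y; case/splitPr: yp pP p_all pU => l r pP p_all pU.
have yl : y \notin l.
  by move: pU; rewrite uniq_catC cons_uniq mem_cat => /andP[/norP[]].
rewrite !index_cat (negbTE yl) /= eqxx addn0.
case: ifP => [ul _|_]; last lia.
have := p_all v; rewrite mem_cat inE.
have [->|vy] := eqVneq v y; first by rewrite (negbTE yl) /= ?eqxx; lia.
have [vl _|_ /= vr _] := boolP (v \in l).
  by move: vl; rewrite -index_mem /=; lia.
exact: hamiltonian_not_articulation pP p_all _ _ ul vr.
Qed.

(** The three vertices have distinct positions on the path, and the middle one is bypassed by the
    edge between the other two. *)
Lemma hamiltonian_no_triangle x y z :
    has_hamiltonian_path e -> e x y -> e y z -> e x z ->
  articulation e x -> articulation e y -> articulation e z -> False.
Proof.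
move=> [p pP p_all] xy yz xz ax ay az.
have idx u v : e u v -> index u p != index v p.
  move=> uv; apply: contraTneq uv => uvE.
  by rewrite -(nth_index u (p_all u)) uvE nth_index // e_irr.
have B := hamiltonian_between pP p_all.
move: (idx _ _ xy) (idx _ _ yz) (idx _ _ xz).
case: ltngtP => // xy' _; case: ltngtP => // yz' _; case: ltngtP => // xz' _.
(* Two of the eight sign patterns are cyclic, hence impossible; the other six are the orders of [x],
   [y], [z]. *)
all: try by lia.
- exact: (B x y z).
- exact: (B x z y).
- by apply: (B z x y) => //; rewrite e_sym.
- by apply: (B y x z) => //; rewrite e_sym.
- by apply: (B y z x) => //; rewrite e_sym.
- by apply: (B z y x) => //; rewrite e_sym.
Qed.

End Graph.

Theorem theorem4 (T : finType) (e : rel T)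
    (e_sym : symmetric e) (e_irr : irreflexive e)
    (e_conn : connected_graph e) (e_4K1 : fourK1_free e) :
  (has_hamiltonian_path e <->
     (forall x : T, articulation e x -> num_components e [set~ x] = 2) /\
     ~ (exists x y z : T,
          [/\ articulation e x, articulation e y & articulation e z] /\
          [/\ e x y, e y z & e x z])) /\
  (~ has_hamiltonian_path e -> has_path_cover e 2).
Proof.
have ham_or := hamiltonian_or_spider e_sym e_conn.
split; last first.
  by case: ham_or => // -[x [l [r [h /spider_path_cover]]]] + _; apply.
split=> [ham|[two_comp no_triangle]].
  split=> [x ax|[x [y [z [[ax ay az] [xy yz xz]]]]]].
    (* [articulation] already gives at least two components, so only the upper bound is left. *)
    apply/eqP; rewrite eqn_leq ax andbT; case: ham => p pP p_all.
    have xp := p_all x; case/splitPr: xp pP p_all => l r pP p_all.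
    exact: hamiltonian_components pP p_all.
  exact: (hamiltonian_no_triangle e_sym e_irr ham xy yz xz).
case: ham_or => // -[x [l [r [h sp]]]]; case: no_triangle.
have ax := spider_articulation e_sym e_irr e_4K1 sp.
by exists x; apply: (spider_triangle e_sym e_irr e_4K1 sp (two_comp x ax)).
Qed.
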